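(* Let $\mathcal{P}$ be a finite nuclear type system on $\Omega$, let $\Delta$ be its nucleus graph and let $(X_\Delta,\sigma)$ be the corresponding subshift of finite type. Then there exists a non-empty clopen set $E\subseteq X_\Delta$ such that $\operatorname{Fix}_V(\mathcal{P})\cong V(\Delta,E)$, and the corresponding group $H_0=\operatorname{coker}(I-A_\Delta)$ is isomorphic to $S(\mathcal{P})$.
   Context: $\mathfrak{C}$ is the Cantor space of infinite words over $\{0,1\}$ and $\Omega$ is the set of all finite words over $\{0,1\}$ (including the empty word), called addresses; $|\alpha|$ is the length of $\alpha$. For $\alpha\in\Omega$ the cone is $\alpha\mathfrak{C}=\{\alpha w\mid w\in\mathfrak{C}\}$. Thompson's group $V$ is the group (under composition) of all maps $\mathfrak{C}\to\mathfrak{C}$ for which there are two partitions $\alpha_1\mathfrak{C},\dots,\alpha_n\mathfrak{C}$ and $\beta_1\mathfrak{C},\dots,\beta_n\mathfrak{C}$ of $\mathfrak{C}$ into disjoint cones such that $\alpha_iw\mapsto\beta_iw$ for all $i$ and all $w\in\mathfrak{C}$. $V$ acts partially on $\Omega$ on the right: $\alpha^g=\beta$ if $g$ maps $\alpha w\mapsto\beta w$ for all $w\in\mathfrak{C}$; if there is no such $\beta$, then $\alpha^g$ is undefined. A type system on $\Omega$ is the partition $\mathcal{P}$ of $\Omega$ into the classes (called types) of an equivalence relation $\sim$ such that for all $\alpha,\beta\in\Omega$: $\alpha\sim\beta$ if and only if both $\alpha0\sim\beta0$ and $\alpha1\sim\beta1$. It is finite if it has finitely many classes. $\operatorname{Fix}_V(\mathcal{P})$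 is the subgroup of all $g\in V$ such that, for all but finitely many $\alpha\in\Omega$, $\alpha^g$ is defined and $\alpha^g\sim\alpha$. For $P\in\mathcal{P}$ and $\gamma\in\Omega$, $P_\gamma$ denotes the type of $\alpha\gamma$ for any $\alpha\in P$. $\mathcal{P}$ is nuclear if there are a positive integer $t$ and a non-empty subset $\mathcal{Q}\subseteq\mathcal{P}$ (the nucleus) such that every address $\alpha$ with $|\alpha|\ge t$ has type in $\mathcal{Q}$; $P\in\mathcal{Q}$ implies $P_0,P_1\in\mathcal{Q}$; and for all $P,Q\in\mathcal{Q}$ there is a non-empty word $\gamma$ with $P_\gamma=Q$ and $P_\zeta\in\mathcal{Q}$ for every prefix $\zeta$ of $\gamma$. The type graph of $\mathcal{P}$ is the directed multigraph with vertex set $\mathcal{P}$ and, for each $P\in\mathcal{P}$, one edge labelled $0$ from $P$ to $P_0$ and one edge labelled $1$ from $P$ to $P_1$. The nucleus graph of $\mathcal{P}$ is the induced subgraph of the type graph on the types in the nucleus. $S(\mathcal{P})$ is the commutative semigroup (written additively) with one generator $p$ for each type $P\in\mathcal{P}$ and relations $p=p_0+p_1$ for each $P\in\mathcal{P}$, where $p_0,p_1$ are the generators corresponding to $P_0,P_1$. For a finite directed multigraph $\Gamma$ with edge set $\mathcal{E}(\Gamma)$, $X_\Gamma\subseteq\mathcal{E}(\Gamma)^{\mathbb{N}}$ is the set of infinite directed paths $e_1e_2e_3\cdots$ in $\Gamma$, with the subspace topology from the product of discrete spaces, and $\sigma$ is the shift map. For a finite directed path $\alpha$ in $\Gamma$,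 the cone $C(\alpha,X_\Gamma)$ is the set of points of $X_\Gamma$ with prefix $\alpha$. If $\alpha,\beta$ are finite directed paths with the same terminal vertex, the prefix-replacement homeomorphism $C(\alpha,X_\Gamma)\to C(\beta,X_\Gamma)$ maps $\alpha\psi\mapsto\beta\psi$. A homeomorphism $f\colon U\to W$ between open subsets of $X_\Gamma$ is Thompson-like if for each $p\in U$ there are a cone $C(\alpha,X_\Gamma)\subseteq U$ containing $p$ and a cone $C(\beta,X_\Gamma)$ containing the image of $p$ such that $f$ maps $C(\alpha,X_\Gamma)$ to $C(\beta,X_\Gamma)$ by a prefix-replacement homeomorphism. For a non-empty clopen $E\subseteq X_\Gamma$, $V(\Gamma,E)$ is the group of all Thompson-like homeomorphisms $E\to E$. $A_\Gamma$ is the adjacency matrix of $\Gamma$ ($(i,j)$ entry is the number of edges from vertex $i$ to vertex $j$), $I$ is the identity matrix of the same size $n$, and $\operatorname{coker}(I-A_\Gamma)$ is the cokernel of the homomorphism $\mathbb{Z}^n\to\mathbb{Z}^n$ given by right multiplication of row vectors by $I-A_\Gamma$. *)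

(* Defs.v *)
From HB Require Import structures.
From mathcomp Require Import all_boot all_order all_algebra finmap generic_quotient.
From mathcomp Require Import ring_quotient.
From mathcomp Require Import all_classical topology cantor.

Set Implicit Arguments.
Unset Strict Implicit.
Unset Printing Implicit Defensive.

Import GRing.Theory.

Local Open Scope quotient_scope.
Local Open Scope fset_scope.
Local Open Scope classical_set_scope.
Local Open Scope ring_scope.

Notation address := (seq bool).

(* The infinite word [s w]: past the end of [s], [nth] returns its default. *)
Definition prepend (T : Type) (s : seq T) (w : nat -> T) : nat -> T :=
  fun n => nth (w (n - size s)%N) s n.

Definition addr_cone (a : address) : set cantor_space :=
  range (prepend a : cantor_space -> cantor_space).

Definition maps_cone (g : cantor_space -> cantor_space) (a b : address) : Prop :=
  forall w : cantor_space, g (prepend a w) = prepend b w.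

Definition thompson_V : set (cantor_space -> cantor_space) :=
  [set g | exists n (a b : 'I_n -> address),
     [/\ partition setT (addr_cone \o a) setT,
         partition setT (addr_cone \o b) setT
       & forall i, maps_cone g (a i) (b i)]].

Record type_system := TypeSystem {
  ts_rel :> equiv_rel address;
  ts_relP : forall a b : address,
    ts_rel a b = ts_rel (rcons a false) (rcons b false)
              && ts_rel (rcons a true) (rcons b true) }.

Definition types (P : type_system) := {eq_quot P}.
HB.instance Definition _ P := Choice.on (types P).
HB.instance Definition _ (P : type_system) := EqQuotient.on (types P).

Definition type_of (P : type_system) (a : address) : types P := \pi_(types P) a.

(* [subtype p c] is the type written P_γ; by [subtype_of] below it does not
   depend on the representative. *)
Definition subtype (P : type_system) (p : types P) (c : address) : types P :=
  type_of P (repr p ++ c).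

Lemma subtype_of (P : type_system) (a c : address) :
  subtype (type_of P a) c = type_of P (a ++ c).
Proof.
apply/eqmodP; elim/last_ind: c => [|c x IHc].
  by rewrite !cats0; apply/eqmodP; rewrite reprK.
by move: IHc; rewrite -!rcons_cat ts_relP => /andP[]; case: x.
Qed.

Definition finite_type_system (P : type_system) : Prop :=
  finite_set [set: types P].

Definition fix_V (P : type_system) : set (cantor_space -> cantor_space) :=
  [set g | thompson_V g /\
     finite_set [set a : address | ~ exists2 b, maps_cone g a b & P b a]].

(* For a finite type system every set of types is an [{fset types P}]. *)
Definition is_nucleus (P : type_system) (Q : {fset types P}) : Prop :=
  [/\ Q != fset0,
      exists2 t : nat, (0 < t)%N &
        forall a : address, (t <= size a)%N -> type_of P a \in Q,
      forall p, p \in Q ->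
        subtype p [:: false] \in Q /\ subtype p [:: true] \in Q
    & forall p q, p \in Q -> q \in Q ->
        exists c : address, [/\ c != [::], subtype p c = q
          & forall z : address, prefix z c -> subtype p z \in Q]].

Record multigraph := Multigraph {
  vertex : finType;
  edge : finType;
  src : edge -> vertex;
  tgt : edge -> vertex }.

Definition adjacency (G : multigraph) : 'M[int]_#|vertex G| :=
  \matrix_(i, j) #|[pred e : edge G |
    (src e == enum_val i) && (tgt e == enum_val j)]|%:Z.

Fixpoint is_walk (G : multigraph) (v : vertex G) (s : seq (edge G)) : bool :=
  if s is e :: s' then (src e == v) && is_walk (tgt e) s' else true.

(* The origin is recorded so that empty paths have a terminal vertex. *)
Record dipath (G : multigraph) := Dipath {
  origin : vertex G;
  dipath_edges :> seq (edge G);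
  dipath_walk : is_walk origin dipath_edges }.

Definition terminus (G : multigraph) (a : dipath G) : vertex G :=
  last (origin a) (map (@tgt G) a).

Definition edge_shift (G : multigraph) : Type :=
  set_type [set x : prod_topology (fun _ : nat => discrete_topology (edge G)) |
    forall n, tgt (x n) = src (x n.+1)].
HB.instance Definition _ G := Topological.on (edge_shift G).

Definition edges_of (G : multigraph) (x : edge_shift G) : nat -> edge G := val x.

Definition path_cone (G : multigraph) (a : dipath G) : set (edge_shift G) :=
  [set x | src (edges_of x 0) = origin a /\ mkseq (edges_of x) (size a) = a].

Definition homeomorphism (S T : topologicalType) (f : S -> T) : Prop :=
  continuous f /\ exists g : T -> S, [/\ continuous g, cancel f g & cancel g f].

Definition prefix_replacement (G : multigraph) (U W : set (edge_shift G))
    (f : U -> W) (a b : dipath G) : Prop :=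
  terminus a = terminus b /\
  forall (x : U) (psi : nat -> edge G), path_cone a (val x) ->
    edges_of (val x) = prepend a psi -> edges_of (val (f x)) = prepend b psi.

Definition thompson_like (G : multigraph) (U W : set (edge_shift G))
    (f : U -> W) : Prop :=
  forall x : U, exists a b : dipath G,
    [/\ path_cone a `<=` U, path_cone a (val x), path_cone b (val (f x))
      & prefix_replacement f a b].

Definition thompson_group (G : multigraph) (E : set (edge_shift G)) :
    set (E -> E) :=
  [set f | homeomorphism f /\ thompson_like f].
Arguments thompson_group {G} E.

(* Isomorphism of groups of self-maps, with composition as group law. *)
Definition map_group_iso (S T : Type) (A : set (S -> S)) (B : set (T -> T)) :
    Prop :=
  exists phi : (S -> S) -> (T -> T), set_bij A B phi /\
    forall f g, A f -> A g -> phi (f \o g) = phi f \o phi g.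

Section NucleusGraph.
Variables (P : type_system) (Q : {fset types P}).

Definition nucleus_edge : Type :=
  {e : Q * bool | subtype (val e.1) [:: e.2] \in Q}.
HB.instance Definition _ := Finite.on nucleus_edge.

Definition nucleus_graph : multigraph :=
  @Multigraph Q nucleus_edge
    (fun e => (val e).1) (fun e => [` valP e]).

End NucleusGraph.

Definition row_image (n : nat) (M : 'M[int]_n) : {pred 'rV[int]_n} :=
  fun v => `[< exists u : 'rV[int]_n, v = u *m M >].

Lemma row_image_zmod_closed (n : nat) (M : 'M[int]_n) :
  zmod_closed (row_image M).
Proof.
split; first by apply/asboolP; exists 0; rewrite mul0mx.
move=> _ _ /asboolP[u ->] /asboolP[v ->].
by apply/asboolP; exists (u - v); rewrite mulmxBl.
Qed.

HB.instance Definition _ (n : nat) (M : 'M[int]_n) :=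
  GRing.isZmodClosed.Build _ (row_image M) (row_image_zmod_closed M).

Definition coker (n : nat) (M : 'M[int]_n) : zmodType :=
  Quotient.quot (row_image M).

Inductive sgterm (X : Type) := SGen of X | SAdd of sgterm X & sgterm X.

HB.instance Definition _ (X : Type) := gen_eqMixin (sgterm X).
HB.instance Definition _ (X : Type) := gen_choiceMixin (sgterm X).

Inductive sgcong (X : Type) (R : sgterm X -> sgterm X -> Prop) :
    sgterm X -> sgterm X -> Prop :=
| sgcong_rel s t : R s t -> sgcong R s t
| sgcong_refl s : sgcong R s s
| sgcong_sym s t : sgcong R s t -> sgcong R t s
| sgcong_trans s t u : sgcong R s t -> sgcong R t u -> sgcong R s u
| sgcong_add s s' t t' :
    sgcong R s s' -> sgcong R t t' -> sgcong R (SAdd s t) (SAdd s' t')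
| sgcong_comm s t : sgcong R (SAdd s t) (SAdd t s)
| sgcong_assoc s t u : sgcong R (SAdd s (SAdd t u)) (SAdd (SAdd s t) u).

Section Presentation.
Variables (X : Type) (R : sgterm X -> sgterm X -> Prop).

Definition sgcongb : rel (sgterm X) := fun s t => `[< sgcong R s t >].

Lemma sgcongb_equiv : equiv_class_of sgcongb.
Proof.
split=> [s|s t|t s u].
- by apply/asboolP; exact: sgcong_refl.
- by apply/asboolP/asboolP; exact: sgcong_sym.
- by move=> /asboolP st /asboolP tu; apply/asboolP; exact: sgcong_trans st tu.
Qed.

Canonical sgcongb_equivRel := EquivRelPack sgcongb_equiv.
Canonical sgcongb_encModRel := defaultEncModRel sgcongb.

Definition presented := {eq_quot sgcongb}.
HB.instance Definition _ := Choice.on presented.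
HB.instance Definition _ := EqQuotient.on presented.

Definition presented_add (x y : presented) : presented :=
  \pi_presented (SAdd (repr x) (repr y)).

Lemma presented_addE s t :
  presented_add (\pi_presented s) (\pi_presented t) = \pi_presented (SAdd s t).
Proof.
have reprE r : sgcong R (repr (\pi_presented r)) r.
  by apply/asboolP; apply/(@eqmodP _ sgcongb_equivRel); rewrite reprK.
by apply/eqmodP/asboolP; exact: sgcong_add.
Qed.

Lemma presented_addC : commutative presented_add.
Proof. by move=> x y; apply/eqmodP/asboolP; exact: sgcong_comm. Qed.

Lemma presented_addA : associative presented_add.
Proof.
elim/quotW=> x; elim/quotW=> y; elim/quotW=> z.
rewrite (presented_addE y z) (presented_addE x y).
rewrite (presented_addE x) (presented_addE _ z).
by apply/eqmodP/asboolP; exact: sgcong_assoc.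
Qed.

HB.instance Definition _ :=
  GRing.isAddSemigroup.Build presented presented_addC presented_addA.

End Presentation.

Inductive type_relation (P : type_system) :
    sgterm (types P) -> sgterm (types P) -> Prop :=
| TypeRelation p :
    type_relation (SGen p)
      (SAdd (SGen (subtype p [:: false])) (SGen (subtype p [:: true]))).

Definition type_semigroup (P : type_system) : addSemigroupType :=
  presented (@type_relation P).

Definition add_iso (A B : addSemigroupType) : Prop :=
  exists phi : A -> B, bijective phi /\ {morph phi : x y / x + y}.

(* Main.v *)
(* S(P) is a group: the nucleus graph is strongly connected with out-degree 2, so
   every generator is a summand of every element, and x = y + z is always
   solvable.  Expanding a type t levels down writes it as a sum of nucleus types
   modulo the rows of I - A; this is inverse to sending a basis vector of
   Z^n to its generator.
   For the groups, fix a nucleus type p0.  Infinite paths from p0 are identified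
   with infinite words through edge labels.  For each address a of length t the
   type p0_a can be connected to the type of a inside the nucleus, giving an
   extension tau(a) of a with p0_tau(a) = type of a.  Then h : a w |-> path from p0
   labelled tau(a) w is an injection of Cantor space with clopen image E, carrying
   the cone of a long address a to a cone whose path ends at the type of a.
   Conjugation by h turns the condition that g maps a w to b w with b ~ a into
   prefix replacement between paths with a common terminus; König's lemma turns the pointwise
   condition defining V(Delta, E) into the condition at all but finitely many
   addresses. *)
Require Import Defs.
From HB Require Import structures.
From mathcomp Require Import all_boot all_order all_algebra finmap zify.
From mathcomp Require Import generic_quotient ring_quotient.
From mathcomp Require Import all_classical topology cantor.

Set Implicit Arguments.
Unset Strict Implicit.
Unset Printing Implicit Defensive.

Import GRing.Theory.

Local Open Scope quotient_scope.
Local Open Scope fset_scope.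
Local Open Scope classical_set_scope.
Local Open Scope ring_scope.

(** * Types of extended addresses *)

Lemma type_ofP (P : type_system) (a b : address) :
  type_of P a = type_of P b <-> P a b.
Proof. by split=> [/eqmodP|ab]; last exact/eqmodP. Qed.

Lemma subtype0 (P : type_system) (p : types P) : subtype p [::] = p.
Proof. by rewrite /subtype cats0 /type_of reprK. Qed.

Lemma subtype_cat (P : type_system) (p : types P) (c d : address) :
  subtype p (c ++ d) = subtype (subtype p c) d.
Proof. by rewrite -[subtype p c]/(type_of P (repr p ++ c)) subtype_of -catA. Qed.

Lemma subtype_cons (P : type_system) (p : types P) (b : bool) (c : address) :
  subtype p (b :: c) = subtype (subtype p [:: b]) c.
Proof. by rewrite -subtype_cat. Qed.

(** * The semigroup S(P) and the cokernel *)

(** If [x0 = x0 + e], then writing any [x] as [x0 + z] shows that [e] is neutral, and solving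
    [e = x + z] gives inverses. The point [x0] only witnesses non-emptiness. The group [Z] has the
    same elements, and [i] is the identity map. *)
Lemma solvable_zmod (T : choiceType) (op : T -> T -> T) (x0 : T) :
  associative op -> commutative op ->
  (forall x y, exists z, x = op y z) ->
  exists (Z : zmodType) (i : T -> Z),
    bijective i /\ {morph i : x y / op x y >-> x + y}.
Proof.
move=> opA opC sol; have [e x0e] := sol x0 x0.
have eP : left_id e op.
  by move=> x; have [z ->] := sol x x0; rewrite opA [op e _]opC -x0e.
have [n nP] := choice (fun x => sol e x).
have nV : left_inverse e n op by move=> x; rewrite opC -nP.
pose m := @Algebra.isZmodule.Axioms_ T (Choice.class T) (Choice.class T)
  e n op opA opC eP nV.
pose Z : zmodType := HB.pack (Choice.sort T) m.
by exists Z, (id : T -> Z); split; first exact: (Bijective (g := id)).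
Qed.

(** Between groups, preserving sums already forces preserving zero, opposites and integer
    combinations. The maps compared below are bare functions known only to preserve sums. *)
Lemma morphD_sum (U V : zmodType) (f : U -> V) : {morph f : x y / x + y} ->
  forall (I : finType) (x : I -> U) (n : I -> int),
    f (\sum_j x j *~ n j) = \sum_j f (x j) *~ n j.
Proof.
move=> fD I x n.
have f0 : f 0 = 0 by apply: (@addrI _ (f 0)); rewrite -fD !addr0.
have fN u : f (- u) = - f u by apply: (@addrI _ (f u)); rewrite -fD !subrr.
have fB : zmod_morphism f by move=> u v; rewrite fD fN.
pose m := GRing.isZmodMorphism.Build U V f fB.
pose f' : {additive U -> V} := HB.pack f m.
rewrite -[f]/(f' : U -> V) raddf_sum; apply: eq_bigr => j _; exact: raddfMz.
Qed.

(** * Presented commutative semigroups *)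

Section Presented.
Variables (X : Type) (R : sgterm X -> sgterm X -> Prop).

Definition sggen (x : X) : presented R := \pi_(presented R) (SGen x).

Lemma pi_addE (s t : sgterm X) :
  \pi_(presented R) (SAdd s t) = \pi_(presented R) s + \pi_(presented R) t.
Proof. by rewrite -[RHS]/(presented_add _ _) presented_addE. Qed.

Lemma presented_ind (K : presented R -> Prop) :
  (forall x, K (sggen x)) -> (forall x y, K x -> K y -> K (x + y)) ->
  forall s, K s.
Proof.
move=> Kg KD; elim/quotW; elim=> [x|s Ks t Kt]; first exact: Kg.
by rewrite pi_addE; exact: KD.
Qed.

Fixpoint sgeval (Z : addSemigroupType) (f : X -> Z) (s : sgterm X) : Z :=
  match s with SGen x => f x | SAdd s t => sgeval f s + sgeval f t end.

(** The universal property of the presentation: evaluation of terms is constant on classes of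
    [sgcong], so it can be computed on representatives. *)
Lemma presented_lift (Z : addSemigroupType) (f : X -> Z) :
  (forall s t, R s t -> sgeval f s = sgeval f t) ->
  exists F : presented R -> Z,
    (forall x, F (sggen x) = f x) /\ {morph F : x y / x + y}.
Proof.
move=> fR; have fE s t : sgcong R s t -> sgeval f s = sgeval f t.
  elim=> {s t} //= [s t u _ -> _ -> //|s s' t t' _ -> _ -> //|s t|s t u].
    exact: Algebra.addrC.
  exact: Algebra.addrA.
have piE s : sgeval f (repr (\pi_(presented R) s)) = sgeval f s.
  apply/fE/asboolP/(@eqmodP _ (sgcongb_equivRel R)); exact: reprK.
exists (fun x => sgeval f (repr x)); split=> [x|]; first by rewrite piE.
by elim/quotW=> s; elim/quotW=> t; rewrite -pi_addE !piE.
Qed.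

End Presented.

(** * Summands and solvability in S(P) *)

Section TypeSemigroup.
Variables (P : type_system) (Q : {fset types P}).
Hypothesis nQ : is_nucleus Q.
Notation S := (type_semigroup P).
Notation gen := (sggen (@type_relation P)).

Lemma gen_split (p : types P) :
  gen p = gen (subtype p [:: false]) + gen (subtype p [:: true]) :> S.
Proof.
by rewrite -pi_addE; apply/eqmodP/asboolP;
  apply: sgcong_rel.
Qed.

Lemma gen_summand (p : types P) (c : address) :
  c != [::] -> exists z : S, gen p = gen (subtype p c) + z.
Proof.
elim: c p => // b c IHc p _.
have [z pz] : exists z : S, gen p = gen (subtype p [:: b]) + z.
  by rewrite gen_split; case: b; eexists => //; rewrite Algebra.addrC.
have [->|/(IHc (subtype p [:: b])) [z' pz']] := eqVneq c [::].
  by exists z.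
by exists (z' + z); rewrite pz pz' Algebra.addrA (subtype_cons _ _ c).
Qed.

Lemma nucleus_depth : exists2 t : nat, (0 < t)%N &
  forall p c, (t <= size c)%N -> subtype p c \in Q.
Proof.
have [_ [t t0 tQ] _ _] := nQ; exists t => // p c tc.
by rewrite tQ // size_cat (leq_trans tc) ?leq_addl.
Qed.

(** Repeated splitting brings every type into the nucleus after a bounded number of levels; the
    induction is on that number. *)
Lemma depth_ind (K : types P -> Prop) :
  (forall p, p \in Q -> K p) ->
  (forall p, K (subtype p [:: false]) -> K (subtype p [:: true]) -> K p) ->
  forall p, K p.
Proof.
move=> KQ Ks p; have [t _ tQ] := nucleus_depth.
suff H n q : (forall c, size c = n -> subtype q c \in Q) -> K q.
  by apply: (H t) => c ct; rewrite tQ ?ct.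
elim: n q => [|n IHn] q Hq; first by apply: KQ; rewrite -(subtype0 q) Hq.
by apply: Ks; apply: IHn => c cn; rewrite -subtype_cons Hq //= cn.
Qed.

(** A nucleus generator [gen q] is a summand of every generator: descend into the nucleus along
    zeros, then follow a nucleus path to [q]. A general [y] is a sum of nucleus generators, which
    are split off from [x] one after another. *)
Lemma type_semigroup_solvable (x y : S) : exists z, x = y + z.
Proof.
have genQ q : q \in Q -> forall x : S, exists z, x = gen q + z.
  move=> qQ; elim/presented_ind => [p|{}x {}y [z ->] _]; last first.
    by exists (z + y); rewrite Algebra.addrA.
  have [t t0 tQ] := nucleus_depth; have [_ _ _ con] := nQ.
  have [|z ->] := @gen_summand p (nseq t false); first by case: (t) t0.
  have [|c [c0 <- _]] := con (subtype p (nseq t false)) q _ qQ.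
    by rewrite tQ ?size_nseq.
  have [z' ->] := @gen_summand (subtype p (nseq t false)) c c0.
  by exists (z' + z); rewrite Algebra.addrA.
elim/presented_ind: y x => [p|y y' Hy Hy'] x; last first.
  by have [z ->] := Hy x; have [z' ->] := Hy' z; exists z'; rewrite Algebra.addrA.
move: p x; apply: depth_ind => [p pQ|p H0 H1] x; first exact: genQ.
have [z ->] := H0 x; have [z' ->] := H1 z.
by exists z'; rewrite (gen_split p) Algebra.addrA.
Qed.

(** * Expansion into nucleus types and the cokernel *)

Local Notation G := (nucleus_graph Q).

Definition edge_of (q : Q) (b : bool)
    (H : subtype (val q) [:: b] \in Q) : edge G :=
  exist (fun e : Q * bool => is_true (subtype (val e.1) [:: e.2] \in Q)) (q, b) H.

(** The default 0 outside the nucleus makes this total on types, so that [expand] needs no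
    membership proofs. *)
Definition vunit (p : types P) : 'rV[int]_#|vertex G| :=
  if insub p is Some q then delta_mx 0 (enum_rank (q : vertex G)) else 0.

Lemma vunit_val (q : Q) : vunit (val q) = delta_mx 0 (enum_rank (q : vertex G)).
Proof. by rewrite /vunit valK. Qed.

Lemma vunit_row p : p \in Q ->
  vunit p *m (1%:M - adjacency G) =
  vunit p - (vunit (subtype p [:: false]) + vunit (subtype p [:: true])).
Proof.
move=> pQ; rewrite mulmxBr mulmx1; congr (_ - _).
have [_ _ cl _] := nQ; have [p0 p1] := cl p pQ.
pose q : Q := [` pQ].
rewrite (vunit_val q) -rowE.
rewrite -[subtype p [:: false]]/(val [` p0]) -[subtype p [:: true]]/(val [` p1]).
rewrite !vunit_val; apply/rowP => j; rewrite !mxE enum_rankK.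
(* The edges leaving [q] are [e false] and [e true], possibly parallel, so counting edges becomes a
   sum over the two labels. *)
pose e (b : bool) : edge G :=
  if b as b return edge G then edge_of (q := q) p1 else edge_of (q := q) p0.
have srcE (x : edge G) : src x == q -> x = e (val x).2.
  case: x => -[q' b] H /= /eqP qE; apply: val_inj => /=; move: H.
  by rewrite /= qE; case: b.
have -> : #|[pred x : edge G | (src x == q) && (tgt x == enum_val j)]| =
    ((tgt (e false) == enum_val j) + (tgt (e true) == enum_val j))%N.
  rewrite -sum1_card big_mkcondr /=.
  rewrite (reindex_onto e (fun x : edge G => (val x).2)) => [|x /srcE //].
  rewrite (eq_bigl xpredT) => [|[]]; last 2 first.
  - by rewrite /= !eqxx.
  - by rewrite /= !eqxx.
  rewrite big_bool addnC.
  by congr addn; case: (_ == _).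
have D (u : vertex G) : (u == enum_val j)%:Z = ((j == enum_rank u)%:R : int).
  by rewrite -(inj_eq enum_rank_inj) enum_valK eq_sym; case: eqP.
rewrite PoszD !D !eqxx; congr (_%:R + _%:R); congr (nat_of_bool (_ == enum_rank _));
  exact: val_inj.
Qed.

Fixpoint expand (n : nat) (p : types P) : 'rV[int]_#|vertex G| :=
  if n is m.+1 then
    expand m (subtype p [:: false]) + expand m (subtype p [:: true])
  else vunit p.

Local Notation M := (1%:M - adjacency G).
Local Notation pi := (\pi_(coker M)).

Lemma pi_vunit_split p : p \in Q ->
  pi (vunit p) = pi (vunit (subtype p [:: false])) + pi (vunit (subtype p [:: true])).
Proof.
move=> pQ; rewrite -raddfD; apply/eqP; rewrite -Quotient.idealrBE -vunit_row //.
by apply/asboolP; exists (vunit p).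
Qed.

(** Once all types at level [n] lie in the nucleus, splitting each of them once more changes the
    vector only by rows of I - A. *)
Lemma pi_expandS n p : (forall c, size c = n -> subtype p c \in Q) ->
  pi (expand n p) = pi (expand n.+1 p).
Proof.
elim: n p => [|n IHn] p pQ.
  by rewrite /= raddfD; apply: pi_vunit_split; rewrite -(subtype0 p) pQ.
rewrite [LHS]raddfD [RHS]raddfD; congr (_ + _); apply: IHn => c cn;
  by rewrite -subtype_cons pQ //= cn.
Qed.

Lemma pi_expand_nucleus n p : p \in Q -> pi (expand n p) = pi (vunit p).
Proof.
have [_ _ cl _] := nQ.
elim: n p => [//|n IHn] p pQ; have [p0 p1] := cl p pQ.
by rewrite [LHS]raddfD pi_vunit_split //; congr (_ + _); apply: IHn.
Qed.

Lemma vec_vunit (v : 'rV[int]_#|vertex G|) :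
  v = \sum_j vunit (val (enum_val j)) *~ v 0 j.
Proof.
rewrite [LHS]row_sum_delta; apply: eq_bigr => j _.
by rewrite vunit_val enum_valK -scaler_int intz.
Qed.

(** [F] sends basis vectors to generators and kills the rows of I - A. [Psi] sends a generator to
    the class of its expansion at level [t]. Since [Psi] after [F] is the projection, [F] is
    injective on the cokernel; it is onto because [F (expand t p)] is the generator of [p]. *)
Lemma coker_type_semigroup : add_iso (coker M) S.
Proof.
have [t t0 tQ] := nucleus_depth.
(* Integer multiples need a group structure, so S(P) is replaced by its copy [Z]. *)
have [Z [i [ibij iD]]] := @solvable_zmod S +%R (gen (type_of P [::]))
  (@Algebra.addrA S) (@Algebra.addrC S) type_semigroup_solvable.
have [i' iK i'K] := ibij.
have i'D : {morph i' : x y / x + y}.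
  by move=> x y; apply: (can_inj iK); rewrite iD !i'K.
pose igen (j : 'I_#|vertex G|) := i (gen (val (enum_val j))).
pose F (v : 'rV[int]_#|vertex G|) := \sum_j igen j *~ v 0 j.
have FD : {morph F : u v / u + v}.
  by move=> u v; rewrite -big_split; apply: eq_bigr => j _; rewrite mxE mulrzDr.
have Funit p : p \in Q -> F (vunit p) = i (gen p).
  move=> pQ; rewrite (vunit_val [` pQ]) /F (bigD1 (enum_rank ([` pQ] : vertex G))) //=.
  rewrite mxE !eqxx /igen enum_rankK big1 ?addr0 // => j /negbTE jq.
  by rewrite mxE jq.
have F0 u : F (u *m M) = 0.
  rewrite mulmx_sum_row.
  under eq_bigr do rewrite -[u 0 _]intz scaler_int.
  rewrite (morphD_sum FD) big1 // => j _.
  have pQ := valP (enum_val j : Q); set p := val _ in pQ.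
  have [_ _ cl _] := nQ; have [p0 p1] := cl p pQ.
  suff -> : F (row j M) = 0 by rewrite mul0rz.
  rewrite rowE -(enum_valK j) -vunit_val vunit_row // -/p.
  apply: (@addIr _ (F (vunit (subtype p [:: false]) + vunit (subtype p [:: true])))).
  by rewrite -FD subrK add0r FD !Funit // -iD -gen_split.
have F_expand n p : (forall c, size c = n -> subtype p c \in Q) ->
    F (expand n p) = i (gen p).
  elim: n p => [|n IHn] p pQ; first by rewrite Funit // -(subtype0 p) pQ.
  rewrite FD !IHn -?iD -?gen_split // => c cn;
    by rewrite -subtype_cons pQ //= cn.
have tQ' p c : size c = t -> subtype p c \in Q by move=> ct; rewrite tQ ?ct.
have [|Psi [Psi_gen PsiD]] :=
    @presented_lift _ (@type_relation P) (coker M) (pi \o expand t).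
  (* The relation for [p] holds because expanding both halves to level [t] expands [p] to level
     [t.+1]. *)
  move=> _ _ [p] /=; rewrite -raddfD -[expand t _ + _]/(expand t.+1 p).
  exact: pi_expandS (tQ' p).
have PsiF v : Psi (i' (F v)) = pi v.
  have D : {morph Psi \o i' : x y / x + y} by move=> x y /=; rewrite i'D PsiD.
  rewrite -[LHS]/((Psi \o i') (F v)) (morphD_sum D) [in RHS](vec_vunit v).
  rewrite (morphD_sum (raddfD pi)); apply: eq_bigr => j _.
  by rewrite /= iK Psi_gen /= pi_expand_nucleus ?valP.
have Fpi v : F (repr (pi v)) = F v.
  have /eqP : repr (pi v) = v %[mod coker M] by rewrite reprK.
  rewrite -Quotient.idealrBE => /asboolP[u vu].
  by rewrite -[repr _](subrK v) vu FD F0 add0r.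
exists (fun x => i' (F (repr x))); split; last first.
  elim/quotW=> u; elim/quotW=> v.
  by rewrite -[pi u + pi v]raddfD !Fpi FD i'D.
have surj s : exists x : coker M, i' (F (repr x)) = s.
  elim/presented_ind: s => [p|_ _ [x <-] [y <-]].
    by exists (pi (expand t p)); rewrite Fpi F_expand ?iK //; exact: tQ'.
  exists (pi (repr x + repr y)).
  by rewrite Fpi FD i'D.
have [g gP] := choice surj.
(* The section [g] is also a left inverse, because [Psi] recovers an element of the cokernel from
   its image. *)
exists g => // x; have PsiF' y : Psi (i' (F (repr y))) = y by rewrite PsiF reprK.
by rewrite -[LHS]PsiF' gP PsiF'.
Qed.

End TypeSemigroup.

Local Open Scope nat_scope.

(** * Cones of Cantor space and Fix_V(P) *)

Section Prepend.
Variable T : Type.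
Implicit Types (s : seq T) (w : nat -> T).

Definition shiftn n w : nat -> T := fun i => w (n + i).

Lemma prepend_lt x0 s w n : n < size s -> prepend s w n = nth x0 s n.
Proof. by move=> ns; rewrite /prepend (set_nth_default x0). Qed.

Lemma prepend_ge s w n : size s <= n -> prepend s w n = w (n - size s).
Proof. by move=> ns; rewrite /prepend nth_default. Qed.

Lemma prepend_cat s s' w : prepend (s ++ s') w = prepend s (prepend s' w).
Proof.
apply/funext => n; have [ns|ns] := ltnP n (size s).
  by rewrite !(prepend_lt (w 0)) // ?size_cat ?(leq_trans ns) ?leq_addr // nth_cat ns.
rewrite [RHS]prepend_ge //; have [ns'|ns'] := ltnP n (size (s ++ s')).
  rewrite !(prepend_lt (w 0)) // ?nth_cat ?ltnNge ?ns //.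
  by move: ns'; rewrite size_cat; lia.
by rewrite !prepend_ge // ?size_cat ?subnDA //; move: ns'; rewrite size_cat; lia.
Qed.

Lemma shiftn_prepend s w n : shiftn (size s + n) (prepend s w) = shiftn n w.
Proof.
by apply/funext => i; rewrite /shiftn prepend_ge; [congr w|]; lia.
Qed.

Lemma shift_prepend s w : shiftn (size s) (prepend s w) = w.
Proof. by rewrite -[size s]addn0 shiftn_prepend. Qed.

Lemma mkseq_prepend s w n : mkseq (prepend s w) (size s + n) = s ++ mkseq w n.
Proof.
rewrite /mkseq iotaD map_cat; congr (_ ++ _).
  case: s => // x0 s; rewrite -[RHS](mkseq_nth x0); apply/eq_in_map => i.
  by rewrite mem_iota => /andP[_ i_lt]; rewrite (prepend_lt x0).
rewrite -[0 + _]addn0 add0n iotaDl -map_comp; apply: eq_map => i /=.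
by rewrite prepend_ge ?leq_addr // addKn.
Qed.

Lemma mkseq_prepend_size s w : mkseq (prepend s w) (size s) = s.
Proof. by rewrite -[size s]addn0 mkseq_prepend cats0. Qed.

Lemma prepend_mkseq w n : prepend (mkseq w n) (shiftn n w) = w.
Proof.
apply/funext => i; have [i_lt|i_ge] := ltnP i n.
  by rewrite (prepend_lt (w 0)) ?size_mkseq // nth_mkseq.
by rewrite prepend_ge ?size_mkseq // /shiftn subnKC.
Qed.

Lemma prepend_inj s : injective (prepend s).
Proof. by move=> w w' E; rewrite -(shift_prepend s w) E shift_prepend. Qed.

Lemma mkseqD w m n : mkseq w (m + n) = mkseq w m ++ mkseq (shiftn m w) n.
Proof.
by have := mkseq_prepend (mkseq w m) (shiftn m w) n; rewrite prepend_mkseq size_mkseq.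
Qed.

(** Two finite prefixes of one infinite word are comparable. *)
Lemma prepend_eq s w s' w' : size s <= size s' ->
  prepend s w = prepend s' w' -> exists2 c, s' = s ++ c & w = prepend c w'.
Proof.
move=> le_ss' E; have Es : s' = s ++ mkseq w (size s' - size s).
  by rewrite -mkseq_prepend subnKC // E mkseq_prepend_size.
exists (mkseq w (size s' - size s)) => //.
by apply: (@prepend_inj s); rewrite -prepend_cat -Es.
Qed.

End Prepend.

(** * Fix_V(P) through cones of long addresses *)

Section FixV.
Variable P : type_system.
Implicit Types g h : cantor_space -> cantor_space.

Definition fixes_cone g (a : address) : Prop :=
  exists2 b : address, maps_cone g a b & P b a.

Lemma maps_cone_cat g (a b c : address) :
  maps_cone g a b -> maps_cone g (a ++ c) (b ++ c).
Proof. by move=> gab w; rewrite !prepend_cat gab. Qed.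

Lemma ts_rel_cat (a b c : address) : P a b -> P (a ++ c) (b ++ c).
Proof.
by move=> /type_ofP ab; apply/type_ofP; rewrite -!subtype_of ab.
Qed.

Lemma fixes_cone_cat g (a c : address) : fixes_cone g a -> fixes_cone g (a ++ c).
Proof.
by move=> [b gab ba]; exists (b ++ c); [exact: maps_cone_cat|exact: ts_rel_cat].
Qed.

(** A length bound expresses the exclusion of finitely many addresses, since only finitely many are
    shorter than [m]. *)
Definition fixes_deep_cones g :=
  exists m, forall a : address, m <= size a -> fixes_cone g a.

Lemma thompson_V_bij g : thompson_V g -> bijective g.
Proof.
move=> [n [a [b [[acov atriv _] [bcov btriv _] gab]]]].
rewrite -setTT_bijective; split=> //.
- move=> x y _ _.
  have : cover setT (addr_cone \o a) x by rewrite acov.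
  have : cover setT (addr_cone \o a) y by rewrite acov.
  move=> [i _ [v _ <-]] [j _ [w _ <-]]; rewrite !gab => E.
  have ji : j = i.
    by apply: btriv => //; exists (prepend (b j) w); split; [exists w|exists v].
  by move: E; rewrite ji => /prepend_inj ->.
- move=> y _; have : cover setT (addr_cone \o b) y by rewrite bcov.
  by move=> [i _ [v _ <-]]; exists (prepend (a i) v) => //; rewrite gab.
Qed.

Lemma finite_addr_size (A : set address) :
  finite_set A -> exists m, forall a, A a -> size a < m.
Proof.
move=> /finite_seqP[s ->]; exists (\max_(a <- s) size a).+1 => a /= as_.
by rewrite ltnS; apply: leq_bigmax_seq.
Qed.

Lemma short_addr_finite m : finite_set [set a : address | size a < m].
Proof.
apply: (@sub_finite_set _ _ (\bigcup_(k in `I_m) range (@tval k bool))).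
  by move=> a /= am; exists (size a) => //; exists (in_tuple a).
by apply: bigcup_finite => // k _; apply: finite_image; exact: finite_finset.
Qed.

(** A bijection carries the partition into cones of words of length [m] to another partition. Words
    are enumerated by ordinals to match [thompson_V]; taking [g] and [b] to be identities yields the
    domain partition. *)
Lemma words_partition m (g : cantor_space -> cantor_space) (b : address -> address) :
  bijective g ->
  (forall a, size a = m -> maps_cone g a (b a)) ->
  partition setT (addr_cone \o (b \o fun i : 'I_#|{:m.-tuple bool}| => tval (enum_val i)))
    setT.
Proof.
move=> [g' gK g'K] gb; split.
- apply/seteqP; split=> // x _.
  have sz : size (mkseq (g' x) m) == m by rewrite size_mkseq.
  exists (enum_rank (Tuple sz)) => //=; rewrite enum_rankK /=.
  exists (shiftn m (g' x)) => //; rewrite -gb ?(eqP sz) //.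
  by rewrite prepend_mkseq g'K.
- move=> i j _ _ [x [[v _ <-] [w _]]] /=.
  rewrite -!gb ?size_tuple // => /(can_inj gK) E.
  apply/enum_val_inj/val_inj => /=.
  have tw (u : m.-tuple bool) z : mkseq (prepend u z) m = u.
    by have := mkseq_prepend_size u z; rewrite size_tuple.
  by rewrite -(tw _ v) -E tw.
- by move=> i _; exists (prepend (b (enum_val i)) (fun=> false)); exists (fun=> false).
Qed.

Lemma fix_VP g : fix_V P g <-> bijective g /\ fixes_deep_cones g.
Proof.
split=> [[gV fin]|[gbij [m gm]]].
  split; first exact: thompson_V_bij.
  have [m Hm] := finite_addr_size fin; exists m => a am.
  by apply: contrapT => /Hm; rewrite ltnNge am.
split; last first.
  apply: sub_finite_set (short_addr_finite m) => a /= na.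
  by rewrite ltnNge; apply/negP => /gm.
have /choice[b gb] (a : address) : exists b, size a = m -> maps_cone g a b.
  have [am|am] := eqVneq (size a) m.
    by have [|b] := gm a; [rewrite am|exists b].
  (* An arbitrary value at other lengths, so that [b] is a total function. *)
  by exists [::] => /eqP; rewrite (negbTE am).
exists #|{:m.-tuple bool}|, (fun i => tval (enum_val i)),
  (fun i => b (tval (enum_val i))).
split; last by move=> i; apply: gb; rewrite size_tuple.
  apply: (@words_partition m id id) => //; exact: (Bijective (g := id)).
exact: words_partition gb.
Qed.

(** An address at least as long as every image [b u] of a word [u] of length [m] must extend one of
    these images, and there the inverse is again a prefix replacement preserving types. *)
Lemma fixes_deep_cones_inv g h : cancel g h -> cancel h g ->
  fixes_deep_cones g -> fixes_deep_cones h.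
Proof.
move=> gK hK [m gm].
have /choice[b gb] (a : address) : exists b, size a = m -> maps_cone g a b /\ P b a.
  have [am|am] := eqVneq (size a) m.
    by have [|b] := gm a; [rewrite am|exists b].
  by exists [::] => /eqP; rewrite (negbTE am).
exists (\max_(u : m.-tuple bool) size (b u)) => b0 b0m.
(* One point of the cone of [b0] suffices to find the word [a] whose image is a prefix of [b0]; the
   padding is arbitrary. *)
pose x := h (prepend b0 (fun=> false)); pose a := mkseq x m.
have am : size a = m by rewrite size_mkseq.
have [gab ba] := gb a am.
have lb : size (b a) <= size b0.
  by apply: leq_trans b0m; rewrite -[a]/(tval (Tuple (introT eqP am))) leq_bigmax.
have E : prepend (b a) (shiftn m x) = prepend b0 (fun=> false).
  by rewrite -gab prepend_mkseq hK.
have [c -> _] := prepend_eq lb E.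
exists (a ++ c); last by apply: ts_rel_cat; rewrite equiv_sym.
by move=> w; rewrite prepend_cat -gab gK -prepend_cat.
Qed.

(* König's lemma on the binary tree of addresses. *)
Lemma fixes_deep_conesP g :
  (forall w : cantor_space, exists n, fixes_cone g (mkseq w n)) ->
  fixes_deep_cones g.
Proof.
move=> gfix; apply: contrapT => nfix.
pose bad (a : address) := forall m, exists2 c, m <= size c & ~ fixes_cone g (a ++ c).
have bad0 : bad [::].
  move=> m; apply: contrapT => nb; apply: nfix; exists m => a am.
  by apply: contrapT => na; apply: nb; exists a.
have badS a : bad a -> exists x, bad (rcons a x).
  move=> ba; apply: contrapT => nb.
  have nbx x : exists m, forall c, m <= size c -> fixes_cone g (rcons a x ++ c).
    apply: contrapT => nx; apply: nb; exists x => m.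
    apply: contrapT => nc; apply: nx; exists m => c mc.
    by apply: contrapT => nc'; apply: nc; exists c.
  have [m0 H0] := nbx false; have [m1 H1] := nbx true.
  (* The successor accounts for the letter [x] that selects the child. *)
  have [[|x c] /= cm] := ba (maxn m0 m1).+1; first by [].
  rewrite -cat_rcons; apply; move: cm; rewrite ltnS geq_max => /andP[c0 c1].
  by case: x; [apply: H1|apply: H0].
have /choice[next nextP] (a : address) : exists x, bad a -> bad (rcons a x).
  have [/badS[x bx]|nb] := pselect (bad a); first by exists x.
  by exists false.
pose fix pre n := if n is k.+1 then rcons (pre k) (next (pre k)) else [::].
pose w : cantor_space := fun n => next (pre n).
have preE n : mkseq w n = pre n by elim: n => //= n IHn; rewrite mkseqS IHn.
have badw n : bad (mkseq w n).
  by rewrite preE; elim: n => [//|n IHn]; exact: nextP.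
have [n gn] := gfix w; have [c _] := badw n 0; apply; exact: fixes_cone_cat.
Qed.

End FixV.

(** * Edge shifts and walks in the nucleus graph *)

Section EdgeShiftTopology.
Variable G : multigraph.
Implicit Types x y : edge_shift G.

Lemma edge_shiftP x y : (forall n, edges_of x n = edges_of y n) -> x = y.
Proof. by move=> xy; apply: val_inj; apply/funext. Qed.

Lemma edge_shift_walk x n : tgt (edges_of x n) = src (edges_of x n.+1).
Proof. exact: (set_mem (valP x)). Qed.

Lemma is_walk_mkseq x n : is_walk (src (edges_of x 0)) (mkseq (edges_of x) n).
Proof.
suff H k : is_walk (src (edges_of x k)) (map (edges_of x) (iota k n)) by exact: H.
by elim: n k => [//|n IHn] k /=; rewrite eqxx edge_shift_walk; exact: IHn.
Qed.

Lemma last_tgt_mkseq x n :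
  last (src (edges_of x 0)) (map (@tgt G) (mkseq (edges_of x) n)) = src (edges_of x n).
Proof.
by case: n => [//|n]; rewrite mkseqS map_rcons last_rcons edge_shift_walk.
Qed.

Lemma edges_of_continuous n :
  continuous ((fun x => edges_of x n) : edge_shift G -> discrete_topology (edge G)).
Proof.
move=> x; apply: (@continuous_comp _ _ _ (val : edge_shift G -> _) (fun f => f n)).
  exact: initial_continuous.
exact: (@proj_continuous nat (fun=> discrete_topology (edge G)) n).
Qed.

Lemma nbhs_cylinder x n :
  nbhs x [set y | forall i, i < n -> edges_of y i = edges_of x i].
Proof.
elim: n => [|n IHn]; first by apply: filterS (@filterT _ _ _) => y.
have En : nbhs x [set y | edges_of y n = edges_of x n].
  exact: (@edges_of_continuous n x _ (discrete_set1 _)).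
apply: filterS (filterI IHn En) => y [yx yxn] i.
by rewrite ltnS leq_eqVlt => /orP[/eqP->|/yx].
Qed.

(** The subspace of a product of discrete spaces carries coordinatewise convergence, and a
    coordinate converges when it is eventually constant. *)
Lemma edge_shift_cvg (F : set_system (edge_shift G)) {FF : Filter F} x :
  (forall n, F [set y | edges_of y n = edges_of x n]) -> F --> x.
Proof.
move=> Fx U [V [[W oW <-]] Wx /filterS]; apply.
have /(_ W) : val @ F -->
    (val x : prod_topology (fun _ : nat => discrete_topology (edge G))).
  apply/cvg_sup => n A [B [[C _ <-]] Cx /filterS]; apply.
  have Fn : F [set y | C (edges_of y n)] by apply: filterS (Fx n) => y /= ->.
  exact: Fn.
by apply; apply: open_nbhs_nbhs.
Qed.

Lemma edge_shift_open (A : set (edge_shift G)) :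
  (forall x, A x -> exists n, forall y,
     (forall i, i < n -> edges_of y i = edges_of x i) -> A y) ->
  open A.
Proof.
move=> HA; rewrite openE => x Ax; have [n An] := HA x Ax.
exact: filterS (nbhs_cylinder x n).
Qed.

(** The bound [n] is uniform over [A], so agreement on [n] coordinates also keeps points outside
    [A]; hence the complement is open too. *)
Lemma edge_shift_clopen (A : set (edge_shift G)) n :
  (forall x y, (forall i, i < n -> edges_of y i = edges_of x i) -> A x -> A y) ->
  clopen A.
Proof.
move=> HA; split; first by apply: edge_shift_open => x Ax; exists n => y /HA; apply.
rewrite -(setCK A); apply: open_closedC; apply: edge_shift_open => x nAx.
by exists n => y yx Ay; apply/nAx/(HA y) => // i /yx.
Qed.

Lemma path_cone_prepend (a : dipath G) x :
  path_cone a x -> edges_of x = prepend a (shiftn (size a) (edges_of x)).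
Proof.
by move=> [_ xa]; have := prepend_mkseq (edges_of x) (size a); rewrite xa => ->.
Qed.

Lemma thompson_like_continuous (E : set (edge_shift G)) (f : E -> E) :
  thompson_like f -> continuous f.
Proof.
move=> fT x.
apply: (@continuous_comp_initial E E (edge_shift G) val f) => {}x.
apply: (edge_shift_cvg (FF := fmap_filter _ (nbhs_filter x))) => n.
have [a [b [aE ax bfx [_ fab]]]] := fT x.
(* Coordinate [n] of the image lies in [b] or comes from a coordinate below [size a + n.+1]. The
   successor also makes coordinate 0 agree, which fixes the origin when [a] is empty. *)
have nx : nbhs x (val @^-1` [set y |
    forall i, i < size a + n.+1 -> edges_of y i = edges_of (val x) i]).
  by apply: initial_continuous; exact: nbhs_cylinder.
apply: filterS nx => y /= yx.
have ay : path_cone a (val y).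
  case: ax => [x0 xa]; split; first by rewrite yx ?addnS.
  rewrite -[RHS]xa; apply/eq_in_map => i; rewrite mem_iota => /= ia.
  by apply: yx; rewrite (leq_trans ia) ?leq_addr.
rewrite (fab _ _ ay (path_cone_prepend ay)) (fab _ _ ax (path_cone_prepend ax)).
rewrite /prepend; congr nth; rewrite /shiftn yx //; lia.
Qed.

End EdgeShiftTopology.

(** * Paths in the nucleus graph as labelled words *)

Section Walks.
Variables (P : type_system) (Q : {fset types P}).
Hypothesis nQ : is_nucleus Q.
Local Notation G := (nucleus_graph Q).
Implicit Types (p : Q) (w : nat -> bool) (x : edge_shift G) (c : address).

Lemma nucleus_closed (p : types P) c : p \in Q -> subtype p c \in Q.
Proof.
have [_ _ cl _] := nQ.
elim: c p => [|b c IHc] p pQ; first by rewrite subtype0.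
by rewrite subtype_cons IHc //; have [] := cl p pQ; case: b.
Qed.

Definition nstep p c : Q := [` nucleus_closed c (valP p)].

Definition walk_edge p w n : edge G :=
  edge_of (q := nstep p (mkseq w n)) (nucleus_closed [:: w n] (valP _)).

Lemma walk_edge_walk p w :
  [set x : prod_topology (fun _ : nat => discrete_topology (edge G)) |
     forall n, tgt (x n) = src (x n.+1)] (walk_edge p w).
Proof. by move=> n; apply: val_inj => /=; rewrite mkseqS -cats1 subtype_cat. Qed.

Definition walk p w : edge_shift G :=
  exist _ (walk_edge p w) (mem_set (walk_edge_walk p w)).

Definition label (e : edge G) : bool := (val e).2.

Definition labels x : nat -> bool := label \o edges_of x.

Lemma labels_walk p w : labels (walk p w) = w.
Proof. by []. Qed.

Lemma src_walk p w n : src (edges_of (walk p w) n) = nstep p (mkseq w n).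
Proof. by []. Qed.

Lemma src_walk0 p w : src (edges_of (walk p w) 0) = p.
Proof. by rewrite src_walk; apply: val_inj; rewrite /= subtype0. Qed.

Lemma src_labels x n :
  src (edges_of x n) = nstep (src (edges_of x 0)) (mkseq (labels x) n).
Proof.
elim: n => [|n IHn]; first by apply: val_inj; rewrite /= subtype0.
rewrite -edge_shift_walk mkseqS -cats1; apply: val_inj.
by rewrite /= subtype_cat -[subtype (val _) (mkseq _ _)]/(val (nstep _ _)) -IHn.
Qed.

Lemma edge_eqP (e e' : edge G) : src e = src e' -> label e = label e' -> e = e'.
Proof.
move=> se le; apply: val_inj.
by rewrite [LHS]surjective_pairing [RHS]surjective_pairing; congr pair.
Qed.

(** Each vertex has exactly one outgoing edge per label, so the start and the labels determine the
    path. *)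
Lemma walk_labels x : walk (src (edges_of x 0)) (labels x) = x.
Proof. by apply: edge_shiftP => n; apply: edge_eqP => //; rewrite [RHS]src_labels. Qed.

Lemma walk_inj p : injective (walk p).
Proof. by move=> w w' E; rewrite -(labels_walk p w) E. Qed.

Lemma shift_walk p c w :
  shiftn (size c) (edges_of (walk p (prepend c w))) = edges_of (walk (nstep p c) w).
Proof.
apply/funext => n; apply: edge_eqP.
  rewrite [LHS]src_walk [RHS]src_walk mkseq_prepend.
  by apply: val_inj; rewrite /= subtype_cat.
by rewrite -[LHS]/(shiftn (size c) (prepend c w) n) shift_prepend.
Qed.

Lemma word_path_walk p c :
  is_walk (G := G) p (mkseq (edges_of (walk p (prepend c (fun=> false)))) (size c)).
Proof.
by have := is_walk_mkseq (walk p (prepend c (fun=> false))) (size c); rewrite src_walk0.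
Qed.

Definition word_path p c : dipath G := Dipath (word_path_walk p c).

(** The first [size c] edges depend only on [c], so the padding by [false] in [word_path] is
    immaterial. *)
Lemma word_pathE p c w :
  word_path p c = mkseq (edges_of (walk p (prepend c w))) (size c) :> seq _.
Proof.
apply/eq_in_map => i; rewrite mem_iota => /andP[_ ic].
apply: edge_eqP; last by rewrite -![label _]/(prepend c _ i) !(prepend_lt false).
rewrite [LHS]src_walk [RHS]src_walk; congr nstep.
apply/eq_in_map => j; rewrite mem_iota => /andP[_ ji].
by rewrite !(prepend_lt false) //; apply: (leq_trans ji); exact: ltnW.
Qed.

Lemma size_word_path p c : size (word_path p c) = size c.
Proof. by rewrite size_mkseq. Qed.

Lemma map_label_word_path p c : map label (word_path p c) = c.
Proof.
by rewrite -map_comp -[LHS]/(mkseq (prepend c (fun=> false)) (size c)) mkseq_prepend_size.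
Qed.

Lemma path_cone_word_path p c x :
  path_cone (word_path p c) x <-> exists w, x = walk p (prepend c w).
Proof.
rewrite /path_cone size_word_path; split=> [[x0 xc]|[w ->]]; last first.
  by split; [exact: src_walk0 | rewrite (word_pathE p c w)].
exists (shiftn (size c) (labels x)).
have -> : c = mkseq (labels x) (size c).
  by rewrite -{1}(map_label_word_path p c) -xc -map_comp.
have x0' : src (edges_of x 0) = p := x0.
by rewrite size_mkseq prepend_mkseq -x0' walk_labels.
Qed.

Lemma terminus_word_path p c : terminus (word_path p c) = nstep p c.
Proof.
have := last_tgt_mkseq (walk p (prepend c (fun=> false))) (size c).
by rewrite src_walk0 src_walk mkseq_prepend_size.
Qed.

End Walks.

(** * Realising Fix_V(P) on the nucleus graph *)

Section Realization.
Variables (P : type_system) (Q : {fset types P}).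
Hypothesis nQ : is_nucleus Q.
Local Notation G := (nucleus_graph Q).
Local Notation walk := (walk nQ).
Local Notation nstep := (nstep nQ).
Local Notation word_path := (word_path nQ).

Lemma edges_walk_prepend p c w :
  edges_of (walk p (prepend c w)) =
  prepend (word_path p c) (edges_of (walk (nstep p c) w)).
Proof. by rewrite -shift_walk (word_pathE nQ p c w) prepend_mkseq. Qed.

Lemma walk_prefix p c w w' i : i < size c ->
  edges_of (walk p (prepend c w)) i = edges_of (walk p (prepend c w')) i.
Proof.
move=> ic; rewrite !edges_walk_prepend.
by rewrite !(prepend_lt (edges_of (walk p w) 0)) ?size_word_path.
Qed.

(** The root is the type of the zero word of length [t]. Closure keeps its descendant along [a] in
    the nucleus, and strong connectivity leads from there to the type of [a]. *)
Lemma root_extension : exists t (p0 : Q) (tau : address -> address),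
  forall a, size a = t ->
    take t (tau a) = a /\ val (nstep p0 (tau a)) = type_of P a.
Proof.
have [_ [t _ tQ] _ con] := nQ.
have rQ : type_of P (nseq t false) \in Q by rewrite tQ ?size_nseq.
have /choice[c cP] (a : address) : exists c, size a = t ->
    subtype (subtype (type_of P (nseq t false)) a) c = type_of P a.
  have [at_|at_] := eqVneq (size a) t; last by exists [::] => /eqP; rewrite (negbTE at_).
  have [||c [_ <- _]] := con (subtype (type_of P (nseq t false)) a) (type_of P a).
  - exact: nucleus_closed.
  - by rewrite tQ // at_.
  by exists c.
exists t, [` rQ], (fun a => a ++ c a) => a at_.
by rewrite -{1}at_ take_size_cat // /= subtype_cat cP.
Qed.

Variables (t : nat) (p0 : Q) (tau : address -> address).
Hypothesis tauP : forall a, size a = t ->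
  take t (tau a) = a /\ val (nstep p0 (tau a)) = type_of P a.

(* [tau] fixes the first [t] letters of its argument and corrects the terminal
   type, so following [twist a] from [p0] reaches the type of [a]. *)
Definition twist a := tau (take t a) ++ drop t a.

Definition twistw (w : nat -> bool) : nat -> bool :=
  prepend (tau (mkseq w t)) (shiftn t w).

Lemma twistw_prepend a w : t <= size a -> twistw (prepend a w) = prepend (twist a) w.
Proof.
move=> ta; have st : size (take t a) = t by rewrite size_takel.
have := mkseq_prepend_size (take t a) (prepend (drop t a) w).
have := shift_prepend (take t a) (prepend (drop t a) w).
rewrite -prepend_cat cat_take_drop st /twistw => -> ->.
by rewrite -prepend_cat.
Qed.

Lemma nstep_twist a : t <= size a -> val (nstep p0 (twist a)) = type_of P a.
Proof.
move=> ta; rewrite /= subtype_cat -[X in subtype X _]/(val (nstep p0 (tau (take t a)))).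
have [_ ->] := tauP (size_takel ta).
by rewrite subtype_of cat_take_drop.
Qed.

Lemma mkseq_twistw w : mkseq (twistw w) t = mkseq w t.
Proof.
have [E _] := tauP (size_mkseq w t).
rewrite /twistw -[tau _](cat_take_drop t) E prepend_cat.
have := mkseq_prepend_size (mkseq w t)
  (prepend (drop t (tau (mkseq w t))) (shiftn t w)).
by rewrite size_mkseq.
Qed.

(** [tau] keeps the first [t] letters, so they can be read off from the twisted word, and they
    determine the inserted block. *)
Lemma twistw_inj : injective twistw.
Proof.
move=> w w' E; have Et : mkseq w t = mkseq w' t.
  by rewrite -(mkseq_twistw w) E mkseq_twistw.
move: E; rewrite /twistw Et => /prepend_inj E.
by rewrite -(prepend_mkseq w t) Et E prepend_mkseq.
Qed.

Definition real_map (w : cantor_space) : edge_shift G := walk p0 (twistw w).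

Definition real_set : set (edge_shift G) := range real_map.

Lemma real_map_inj : injective real_map.
Proof. by move=> w w' /walk_inj/twistw_inj. Qed.

Lemma src_real_map w : src (edges_of (real_map w) 0) = p0.
Proof. exact: src_walk0. Qed.

Lemma real_map_prepend a w : t <= size a ->
  real_map (prepend a w) = walk p0 (prepend (twist a) w).
Proof. by move=> ta; rewrite /real_map twistw_prepend. Qed.

Lemma real_set_clopen : clopen real_set.
Proof.
(* Membership is decided by the initial vertex and by labels up to the longest [tau u]; the
   successor ensures that coordinate 0 is compared even if this length is 0. *)
apply: (@edge_shift_clopen _ _ (\max_(u : t.-tuple bool) size (tau u)).+1) => x y yx.
move=> [w _ xw]; set a := mkseq w t.
have at_ : size a = t by rewrite size_mkseq.
have tw : twist a = tau a by rewrite /twist -at_ take_size drop_size cats0.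
have ta : size (tau a) <= \max_(u : t.-tuple bool) size (tau u).
  by rewrite -[a]/(tval (Tuple (introT eqP at_))) leq_bigmax.
have ly : mkseq (labels y) (size (tau a)) = tau a.
  rewrite -[RHS](mkseq_prepend_size _ (shiftn t w)); apply/eq_in_map => i.
  rewrite mem_iota => /andP[_ i_lt]; rewrite /labels /= yx; last first.
    by rewrite ltnS (leq_trans _ ta) // ltnW.
  by rewrite -xw.
exists (prepend a (shiftn (size (tau a)) (labels y))) => //.
rewrite real_map_prepend ?at_ // tw -{1}ly prepend_mkseq.
have <- : src (edges_of y 0) = p0 by rewrite yx // -xw src_real_map.
exact: walk_labels.
Qed.

Lemma real_cone a x : t <= size a ->
  path_cone (word_path p0 (twist a)) x <-> exists w, x = real_map (prepend a w).
Proof.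
move=> ta; rewrite path_cone_word_path.
by split=> -[w ->]; exists w; rewrite real_map_prepend.
Qed.

(** [thompson_group] acts on the subtype of points of E, so the realisation map is restricted to its
    image. *)
Definition real_point (w : cantor_space) : real_set :=
  exist _ (real_map w) (mem_set (imageT real_map w)).

Lemma val_real_point w : val (real_point w) = real_map w.
Proof. by []. Qed.

Lemma real_point_bij : bijective real_point.
Proof.
have surj (x : real_set) : exists w, real_point w = x.
  by have [w _ xw] := set_mem (valP x); exists w; exact: val_inj.
have [k kP] := choice surj; exists k => // w.
by have /(congr1 val)/real_map_inj := kP (real_point w).
Qed.

(** * Conjugation by the realisation map *)

Variable inv_point : real_set -> cantor_space.
Hypotheses (real_pointK : cancel real_point inv_point)
           (inv_pointK : cancel inv_point real_point).

Definition transport (g : cantor_space -> cantor_space) : real_set -> real_set :=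
  real_point \o g \o inv_point.

Lemma transport_comp g g' : transport (g \o g') = transport g \o transport g'.
Proof. by apply/funext => x; rewrite /transport /= real_pointK. Qed.

Lemma transport_thompson_like g : fixes_deep_cones P g -> thompson_like (transport g).
Proof.
move=> [m gm] x; set w := inv_point x.
have xw : x = real_point w by rewrite inv_pointK.
(* Appending the same [t] letters to source and image makes both long enough for [twist]. *)
pose c := mkseq (shiftn m w) t; pose a := mkseq w m ++ c.
have wa : w = prepend a (shiftn t (shiftn m w)) by rewrite prepend_cat !prepend_mkseq.
have [|b' gab' b'a] := gm (mkseq w m); first by rewrite size_mkseq.
pose b := b' ++ c; have gab : maps_cone g a b by exact: maps_cone_cat.
have ba : P b a by exact: ts_rel_cat.
have ta : t <= size a by rewrite size_cat !size_mkseq leq_addl.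
have tb : t <= size b by rewrite size_cat !size_mkseq leq_addl.
have nE : nstep p0 (twist b) = nstep p0 (twist a).
  by apply: val_inj; rewrite !nstep_twist //; exact/type_ofP.
exists (word_path p0 (twist a)), (word_path p0 (twist b)); split.
- by move=> y /real_cone -/(_ ta) [v ->]; exists (prepend a v).
- by apply/real_cone => //; rewrite xw wa; eexists.
- by apply/real_cone => //; rewrite /transport /= -/w wa gab; eexists.
split; first by rewrite !terminus_word_path nE.
move=> y psi /real_cone -/(_ ta) [v yv].
have -> : y = real_point (prepend a v) by exact: val_inj.
have -> : transport g (real_point (prepend a v)) = real_point (prepend b v).
  by rewrite /transport /= real_pointK gab.
rewrite !val_real_point !real_map_prepend // !edges_walk_prepend nE.
by move=> /prepend_inj ->.
Qed.

Lemma transport_homeomorphism g g' : cancel g g' -> cancel g' g ->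
  fixes_deep_cones P g -> homeomorphism (transport g).
Proof.
move=> gK g'K gm; split; first exact/thompson_like_continuous/transport_thompson_like.
exists (transport g'); split.
- apply/thompson_like_continuous/transport_thompson_like.
  exact: fixes_deep_cones_inv gm.
- by move=> x; rewrite /transport /= real_pointK gK inv_pointK.
- by move=> x; rewrite /transport /= real_pointK g'K inv_pointK.
Qed.

Lemma take_mkseqD (T : Type) (w : nat -> T) m n : take m (mkseq w (m + n)) = mkseq w m.
Proof. by rewrite mkseqD take_size_cat ?size_mkseq. Qed.

(** By [fixes_deep_conesP] one fixed cone around each [w] is enough. It is found by refining the
    prefix replacement of [al] by [be] to paths labelled by twisted addresses. *)
Lemma thompson_like_fixes (f : real_set -> real_set) : thompson_like f ->
  fixes_deep_cones P (inv_point \o f \o real_point).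
Proof.
move=> fT; apply: fixes_deep_conesP => w; set g := _ \o _.
have [al [be [alE alx befx [_ fab]]]] := fT (real_point w).
pose w' : cantor_space := g w.
have fx : f (real_point w) = real_point w' by rewrite /w' /g /= inv_pointK.
pose s := size (tau (mkseq w t)); pose s' := size (tau (mkseq w' t)).
(* The lengths are balanced so that [twist a] exceeds [al] and [twist b] exceeds [be] by the same
   amount [s + s']. *)
pose a := mkseq w (t + (size al + s')); pose b := mkseq w' (t + (size be + s)).
have sa : size (twist a) = size al + (s + s').
  by rewrite size_cat take_mkseqD size_drop size_mkseq addKn -/s; lia.
have sb : size (twist b) = size be + (s + s').
  by rewrite size_cat take_mkseqD size_drop size_mkseq addKn -/s'; lia.
have ta : t <= size a by rewrite size_mkseq leq_addr.
have tb : t <= size b by rewrite size_mkseq leq_addr.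
pose v0 := shiftn (t + (size al + s')) w; pose v0' := shiftn (t + (size be + s)) w'.
have wa : w = prepend a v0 by rewrite prepend_mkseq.
have w'b : w' = prepend b v0' by rewrite prepend_mkseq.
have alv v : path_cone al (real_map (prepend a v)).
  move: alx; rewrite val_real_point => -[x0 xal]; split.
    by rewrite src_real_map -x0 src_real_map.
  rewrite -[RHS]xal; apply/eq_in_map => i; rewrite mem_iota => /= i_al.
  rewrite [in RHS]wa !real_map_prepend //; apply: walk_prefix.
  by rewrite sa (leq_trans i_al) ?leq_addr.
have fE v : edges_of (val (f (real_point (prepend a v)))) =
    prepend be (shiftn (size al) (edges_of (walk p0 (prepend (twist a) v)))).
  apply: fab; first exact: alv.
  by rewrite -real_map_prepend //; exact/path_cone_prepend/alv.
(* Beyond the prefix [twist b], the image follows [v] from the end of the path of [twist a]. *)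
have shiftE v : shiftn (size (twist b)) (edges_of (val (f (real_point (prepend a v))))) =
    edges_of (walk (nstep p0 (twist a)) v).
  rewrite fE sb shiftn_prepend -shift_walk sa.
  by apply/funext => i; rewrite /shiftn addnA.
(* Up to that length the image does not depend on [v], so it can be computed at [w] itself, where it
   is a prefix of the path of [w']. *)
have prefE v : mkseq (edges_of (val (f (real_point (prepend a v))))) (size (twist b)) =
    word_path p0 (twist b).
  rewrite (word_pathE nQ p0 _ v0') -real_map_prepend // -w'b.
  rewrite -[real_map w']/(val (real_point w')) -fx [in RHS]wa !fE sb !mkseq_prepend.
  congr cat; apply/eq_in_map => i; rewrite mem_iota => /andP[_ i_lt].
  by apply: walk_prefix; rewrite sa ltn_add2l.
(* The tails of [real_point w] and of its image are the same path, hence start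
   at the same vertex. *)
have nE : nstep p0 (twist a) = nstep p0 (twist b).
  have := shiftE v0; rewrite -wa fx /= w'b real_map_prepend // shift_walk.
  by move=> /(congr1 (fun e : nat -> edge G => src (e 0))); rewrite !src_walk0.
exists (t + (size al + s')), b; last first.
  apply/type_ofP; rewrite -!nstep_twist //; congr val; exact/esym.
move=> v; rewrite /g /=; apply: (can_inj real_pointK); rewrite inv_pointK.
apply: val_inj; apply: edge_shiftP => n; congr (_ n).
rewrite val_real_point real_map_prepend // edges_walk_prepend -nE -shiftE -(prefE v).
by rewrite prepend_mkseq.
Qed.

Lemma transport_iso : map_group_iso (fix_V P) (thompson_group real_set).
Proof.
exists transport; split; last by move=> f g _ _; exact: transport_comp.
have transportK : cancel transport (fun f => inv_point \o f \o real_point).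
  by move=> g; apply/funext => w; rewrite /= /transport /= !real_pointK.
split.
- move=> g /fix_VP[[g' gK g'K] gm]; split.
    exact: transport_homeomorphism gm.
  exact: transport_thompson_like.
- by move=> g g' _ _; exact: (can_inj transportK).
- move=> f [[_ [f' [_ fK f'K]]] fT].
  exists (inv_point \o f \o real_point); last first.
    by apply/funext => x; rewrite /transport /= !inv_pointK.
  apply/fix_VP; split; last exact: thompson_like_fixes.
  exists (inv_point \o f' \o real_point) => w /=.
    by rewrite inv_pointK fK real_pointK.
  by rewrite inv_pointK f'K real_pointK.
Qed.

End Realization.

Theorem theorem6p14 (P : type_system) (Q : {fset types P}) :
  finite_type_system P -> is_nucleus Q ->
  (exists E : set (edge_shift (nucleus_graph Q)),
     [/\ E !=set0, clopen E & map_group_iso (fix_V P) (thompson_group E)]%classic) /\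
  add_iso (coker (1%:M - adjacency (nucleus_graph Q))%R) (type_semigroup P).
Proof.
move=> _ nQ; split; last exact: coker_type_semigroup.
have [t [p0 [tau tauP]]] := root_extension nQ.
have [k pointK kK] := real_point_bij tauP.
exists (real_set nQ t p0 tau); split.
- by exists (real_map nQ t p0 tau (fun=> false)); exists (fun=> false).
- exact: real_set_clopen.
- exact: (transport_iso tauP pointK kK).
Qed.
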